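(* The out-of-order membership problem for the language $L=a^*b^*a^*$ over the alphabet $\{a,b\}$ has $\Theta(\log n)$ space complexity.
   Context: Problem. Let $\Sigma$ be a finite alphabet, let $w=w[1]\cdots w[n]$ be a word of length $n>0$ over $\Sigma$ and let $\pi$ be a permutation of $\{1,\ldots,n\}$. The out-of-order stream of $w$ defined by $\pi$ is the sequence of triples $(w[\pi(i)],\pi(i),n)$ for $i=1,\ldots,n$. In the out-of-order membership problem for a fixed language $L\subseteq\Sigma^*$, the algorithm receives the triples one after the other, for arbitrary $w$ and arbitrary $\pi$, and must decide at the end whether $w\in L$. The length $n$ is known and not counted in the space. Space. Algorithms are deterministic, and only the bits memorized between two consecutive stream elements are counted (computation time and interim memory used while processing an element are ignored). Formally, an algorithm using $s(n)$ bits consists, for each $n\ge 1$, of a set $Q_n$ of memory states with $|Q_n|\le 2^{s(n)}$, an initial state, an update function $Q_n\times\Sigma\times\{1,\ldots,n\}\to Q_n$, and an output function $Q_n\to\{\text{yes},\text{no}\}$, such that for every $w\in\Sigma^n$ and every permutation $\pi$ the output after processing the stream is correct. The problem has space complexity $O(g(n))$ if some algorithm uses $s(n)=O(g(n))$ bits; it has space complexity $\Omega(g(n))$ if every algorithm uses $s(n)=\Omega(g(n))$ bits, where $s=\Omega(g)$ means $\limsup_{n\to\infty}s(n)/g(n)>0$ (Hardy--Littlewood convention). $\Theta(g(n))$ means both $O(g(n))$ and $\Omega(g(n))$ in these senses. *)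

(* Defs.v *)
From HB Require Import structures.
From mathcomp Require Import all_boot all_order all_algebra all_fingroup.
From mathcomp Require Import all_classical all_reals all_analysis.
Set Implicit Arguments.
Unset Strict Implicit.
Unset Printing Implicit Defensive.

Import Order.TTheory GRing.Theory Num.Theory.
Import numFieldNormedType.Exports.

Local Open Scope classical_set_scope.
Local Open Scope ring_scope.

(* Positions are numbered from 0, as elements of 'I_n.  The third component n
   of the stream elements is constant and known to the algorithm: it is the
   index n of the types below. *)
Definition ooo_stream (Sigma : finType) (n : nat)
    (w : n.-tuple Sigma) (pi : 'S_n) : seq (Sigma * 'I_n) :=
  [seq (tnth w (pi i), pi i) | i <- enum 'I_n].

Record ooo_machine (Sigma : finType) (n : nat) := OooMachine {
  ooo_state : finType;
  ooo_init : ooo_state;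
  ooo_update : ooo_state -> Sigma -> 'I_n -> ooo_state;
  ooo_output : ooo_state -> bool
}.

Definition ooo_run (Sigma : finType) (n : nat) (A : ooo_machine Sigma n)
    (s : seq (Sigma * 'I_n)) : ooo_state A :=
  foldl (fun q x => ooo_update q x.1 x.2) (ooo_init A) s.

Definition ooo_algorithm (Sigma : finType) := forall n : nat, ooo_machine Sigma n.

(* Only lengths n > 0 are constrained, here and in [ooo_uses_space]. *)
Definition ooo_decides (Sigma : finType) (A : ooo_algorithm Sigma)
    (L : set (seq Sigma)) : Prop :=
  forall (n : nat) (w : n.-tuple Sigma) (pi : 'S_n), (0 < n)%N ->
    ooo_output (ooo_run (A n) (ooo_stream w pi)) <-> L (tval w).

Definition ooo_uses_space (Sigma : finType) (A : ooo_algorithm Sigma)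
    (s : nat -> nat) : Prop :=
  forall n : nat, (0 < n)%N -> (#|ooo_state (A n)| <= 2 ^ s n)%N.

Definition ooo_space_O (R : realType) (Sigma : finType) (L : set (seq Sigma))
    (g : nat -> R) : Prop :=
  exists (A : ooo_algorithm Sigma) (s : nat -> nat),
    [/\ ooo_decides A L, ooo_uses_space A s &
        (fun n : nat => (s n)%:R : R) =O_\oo g].

(* Hardy-Littlewood Omega: limsup s/g > 0.  This is weaker than the Omega of
   landau.v, which requires the bound for all large n. *)
Definition HL_Omega (R : realType) (f g : nat -> R) : Prop :=
  (0 < limn_esup (fun n : nat => (f n / g n)%:E))%E.

Definition ooo_space_Omega (R : realType) (Sigma : finType)
    (L : set (seq Sigma)) (g : nat -> R) : Prop :=
  forall (A : ooo_algorithm Sigma) (s : nat -> nat),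
    ooo_decides A L -> ooo_uses_space A s ->
    HL_Omega (fun n : nat => (s n)%:R : R) g.

Definition ooo_space_Theta (R : realType) (Sigma : finType)
    (L : set (seq Sigma)) (g : nat -> R) : Prop :=
  ooo_space_O L g /\ ooo_space_Omega L g.

Inductive letter := la | lb.

Definition bool_of_letter (x : letter) : bool := if x is la then false else true.
Definition letter_of_bool (c : bool) : letter := if c then lb else la.
Lemma bool_of_letterK : cancel bool_of_letter letter_of_bool.
Proof. by case. Qed.

HB.instance Definition _ := Finite.copy letter (can_type bool_of_letterK).

Definition lang_aba : set (seq letter) :=
  [set w | exists i j k : nat, w = nseq i la ++ nseq j lb ++ nseq k la].

(* Main.v *)
(* A word lies in a*b*a* iff its set B of b-positions is an interval.
   Upper bound: store min B, 1 + max B and |B|; B is an interval iff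
   |B| = 1 + max B - min B, and (n + 1)^3 states suffice.
   Lower bound: feed the even positions first, with a single b at position 2i.
   If the remaining letters contain a single b at position 2j + 1 with i <= j,
   the word lies in a*b*a* iff i = j, so that the n./2 values of i lead to
   pairwise distinct states. *)
Require Import Defs.
From HB Require Import structures.
From mathcomp Require Import all_boot all_order all_algebra all_fingroup.
From mathcomp Require Import all_classical all_reals all_analysis.
From mathcomp Require Import zify.
Set Implicit Arguments.
Unset Strict Implicit.
Unset Printing Implicit Defensive.
Import Order.TTheory GRing.Theory Num.Theory.
Local Open Scope ring_scope.

(** Lets an arrival order be given as a list of positions: the permutation sends [i] to the [i]-th
    entry of [s]. *)
Lemma ooo_stream_of_perm_eq (n : nat) (s : seq 'I_n) :
  perm_eq s (enum 'I_n) ->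
  exists pi : 'S_n, forall (Sigma : finType) (w : n.-tuple Sigma),
    ooo_stream w pi = [seq (tnth w p, p) | p <- s].
Proof.
move=> sE; have ssz : size s == n by rewrite (perm_size sE) size_enum_ord.
pose t := Tuple ssz.
have tI : injective (tnth t).
  by apply/tuple_uniqP; rewrite (perm_uniq sE) enum_uniq.
exists (perm tI) => Sigma w.
have -> : s = map (tnth t) (enum 'I_n) by rewrite map_tnth_enum.
rewrite -map_comp.
by apply: eq_map => i /=; rewrite permE.
Qed.

(** Fooling-set bound: the positions in [P] arrive first and carry letters fixed by the row [i]; the
    others carry letters fixed by the column [k]. Two rows reaching the same state midway get the
    same answer in every column. *)
Lemma ooo_fooling (Sigma : finType) (n : nat) (A : ooo_machine Sigma n)
    (L : set (seq Sigma)) (P : pred 'I_n) (I : finType)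
    (w : I -> I -> n.-tuple Sigma) :
  (forall v pi, ooo_output (ooo_run A (ooo_stream v pi)) <-> L (tval v)) ->
  (forall i k k' p, P p -> tnth (w i k) p = tnth (w i k') p) ->
  (forall i i' k p, ~~ P p -> tnth (w i k) p = tnth (w i' k) p) ->
  (forall i j, (forall k, L (tval (w i k)) <-> L (tval (w j k))) -> i = j) ->
  (#|I| <= #|ooo_state A|)%N.
Proof.
move=> AL wP wN sep.
pose pre i k := [seq (tnth (w i k) p, p) | p <- enum 'I_n & P p].
pose suf i k := [seq (tnth (w i k) p, p) | p <- enum 'I_n & predC P p].
have preE i k k' : pre i k = pre i k'.
  by apply/eq_in_map => p; rewrite mem_filter => /andP[Pp _]; rewrite (wP _ _ k').
have sufE i i' k : suf i k = suf i' k.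
  by apply/eq_in_map => p; rewrite mem_filter => /andP[Pp _]; rewrite (wN _ i').
have [pi piE] := ooo_stream_of_perm_eq (permEl (perm_filterC P (enum 'I_n))).
have runE i k : ooo_run A (ooo_stream (w i k) pi) =
    foldl (fun q x => ooo_update q x.1 x.2) (ooo_run A (pre i k)) (suf i k).
  by rewrite piE map_cat /ooo_run foldl_cat.
(* The column in [pre i i] is immaterial by [preE]; the diagonal choice also works for empty [I]. *)
apply: (@leq_card _ _ (fun i => ooo_run A (pre i i))) => i j fij.
apply: sep => k; rewrite -!(AL _ pi) !runE (preE i k i) (preE j k j) fij.
by rewrite (sufE i j).
Qed.

Lemma lang_abaP (w : seq letter) :
  lang_aba w <->
  exists lo hi : nat, forall r, (nth la w r == lb) = (lo <= r < hi)%N.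
Proof.
split=> [[i [j [k ->]]]|[lo [hi wE]]].
  exists i, (i + j)%N => r; rewrite !nth_cat !size_nseq !nth_nseq.
  have abF : (la == lb) = false by [].
  by do ![case: ifP => //=] => *; rewrite ?eqxx ?abF; lia.
(* When [w] has no b, [lo] and [hi] may exceed [size w] or be in the wrong order, so both are
   clipped. *)
pose m := minn lo (size w).
exists m, (minn hi (size w) - m)%N,
  (size w - m - (minn hi (size w) - m))%N.
apply: (@eq_from_nth _ la) => [|r rw].
  by rewrite !size_cat !size_nseq /m; lia.
rewrite !nth_cat !size_nseq !nth_nseq.
have := wE r; have abF : (la == lb) = false by [].
by case: (nth la w r); rewrite ?eqxx ?abF /m;
  do ![case: ifP => //=] => *; exfalso; lia.
Qed.

(** The b-positions lie in [iota lo (hi - lo)], so the sizes agree exactly when they fill it. If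
    there is no b, [hi - lo] is 0. *)
Lemma lang_aba_count (w : seq letter) (bs : seq nat) (lo hi : nat) :
  uniq bs -> (forall r, (r \in bs) = (nth la w r == lb)) ->
  (forall r, r \in bs -> (lo <= r < hi)%N) ->
  (hi <= size w)%N -> lo = size w \/ lo \in bs -> hi = 0%N \/ hi.-1 \in bs ->
  (size bs == hi - lo)%N <-> lang_aba w.
Proof.
move=> ubs bsE bsI hiw loP hiP.
have sub : {subset bs <= iota lo (hi - lo)}.
  by move=> r /bsI; rewrite mem_iota; lia.
split=> [/eqP szE|/lang_abaP[i [j wE]]].
  apply/lang_abaP; exists lo, hi => r; rewrite -bsE.
  have [|_ ->] := uniq_min_size ubs sub; first by rewrite size_iota szE.
  by rewrite mem_iota; lia.
have sub' : {subset iota lo (hi - lo) <= bs}.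
  by move: loP hiP; rewrite !bsE !wE => loP hiP r; rewrite mem_iota bsE wE; lia.
rewrite eqn_leq -[X in (_ <= X)%N](size_iota lo) (uniq_leq_size ubs sub) /=.
by rewrite -[X in (X <= _)%N](size_iota lo) (uniq_leq_size (iota_uniq _ _) sub').
Qed.

Definition span_state (n : nat) : finType := ('I_n.+1 * 'I_n.+1 * 'I_n.+1)%type.

(* The three components are the least b-position (n if there is none), one
   plus the greatest b-position (0 if there is none), and the number of b's;
   the junk value of inord is never reached on streams. *)
Definition span_machine (n : nat) : ooo_machine letter n :=
  @OooMachine letter n (span_state n) (ord_max, ord0, ord0)
    (fun q x p => if x is lb
       then (inord (minn q.1.1 p), inord (maxn q.1.2 p.+1), inord q.2.+1)
       else q)
    (fun q => (q.2 == q.1.2 - q.1.1 :> nat)%N).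

Definition b_positions (n : nat) (s : seq (letter * 'I_n)) : seq nat :=
  [seq val x.2 | x <- s & x.1 == lb].

Lemma span_machine_run (n : nat) (s : seq (letter * 'I_n)) :
  (size s <= n)%N ->
  let q : span_state n := ooo_run (span_machine n) s in
  [/\ nat_of_ord q.2 = size (b_positions s),
      forall r, r \in b_positions s -> (q.1.1 <= r < q.1.2)%N,
      nat_of_ord q.1.1 = n \/ nat_of_ord q.1.1 \in b_positions s &
      nat_of_ord q.1.2 = 0%N \/ q.1.2.-1 \in b_positions s].
Proof.
elim/last_ind: s => [_|s [x p] IHs]; first by split=> //=; left.
rewrite size_rcons => sn; have {IHs} := IHs (ltnW sn).
rewrite /ooo_run foldl_rcons -/(ooo_run _ _) /b_positions filter_rcons /=.
case: x => //=; rewrite map_rcons -/(b_positions s) size_rcons /=.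
case: (ooo_run (span_machine n) s) => [[lo hi] c] /= [qc qI qlo qhi].
(* Before one more b is counted the counter is below [n], so its successor still fits in
   ['I_n.+1]. *)
have cn : (c < n)%N.
  by rewrite qc size_map size_filter (leq_ltn_trans (count_size _ _)).
have [[lon hin] pn] := (ltn_ord lo, ltn_ord hi, ltn_ord p).
rewrite !inordK; [split|lia..].
- by rewrite qc.
- by move=> r; rewrite mem_rcons inE => /predU1P[->|/qI]; lia.
(* A minimum left unchanged is not the initial value [n], since [p < n]; dually for the maximum and
   0. *)
- right; rewrite mem_rcons inE; case: leqP => [lop|]; last by rewrite eqxx.
  by case: qlo => [loE|->]; [lia|rewrite orbT].
- right; rewrite mem_rcons inE; case: leqP => [hip|hip]; rewrite /= ?eqxx//.
  by case: qhi => [hiE|->]; [lia|rewrite orbT].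
Qed.

Lemma span_machine_decides : ooo_decides span_machine lang_aba.
Proof.
move=> n w pi _.
set s := ooo_stream w pi.
have sn : size s = n by rewrite size_map size_enum_ord.
have [] := span_machine_run (eq_leq sn).
set q : span_state n := ooo_run (span_machine n) s => qc qI qlo qhi.
rewrite /= -/q qc; apply: lang_aba_count => //.
- rewrite /b_positions map_comp map_inj_uniq; last exact: val_inj.
  apply: (subseq_uniq (map_subseq _ (filter_subseq _ s))).
  by rewrite -map_comp map_inj_uniq ?enum_uniq//; exact: perm_inj.
- move=> r; apply/mapP/eqP => [[[x p]]|wr].
    rewrite mem_filter => /= /andP[/eqP-> /mapP[i _ [-> ->]]] ->.
    by rewrite -tnth_nth.
  have rn : (r < n)%N.
    by have [//|rn] := ltnP r n; rewrite nth_default ?size_tuple in wr.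
  exists (lb, Ordinal rn) => //; rewrite mem_filter eqxx /=.
  apply/mapP; exists (pi^-1%g (Ordinal rn)); rewrite ?mem_enum// permKV.
  by rewrite (tnth_nth la) wr.
- by rewrite size_tuple -ltnS ltn_ord.
- by rewrite size_tuple.
Qed.

Lemma card_state_lower (A : ooo_algorithm letter) (n : nat) :
  ooo_decides A lang_aba -> (0 < n)%N -> (n./2 <= #|ooo_state (A n)|)%N.
Proof.
move=> AL n0; rewrite -[X in (X <= _)%N]card_ord.
pose w (i j : 'I_(n./2)) : n.-tuple letter :=
  [tuple if (r == i.*2 :> nat) || (r == j.*2.+1 :> nat) then lb else la | r < n].
have wE (i j : 'I_(n./2)) r :
    (nth la (w i j) r == lb) = (r == i.*2) || (r == j.*2.+1).
  have [rn|rn] := ltnP r n.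
    by rewrite -(tnth_nth la (w i j) (Ordinal rn)) tnth_mktuple /=; case: ifP.
  have abF : (la == lb) = false by [].
  by rewrite nth_default ?size_tuple// abF; have := ltn_ord i; have := ltn_ord j; lia.
have wL (i : 'I_(n./2)) : lang_aba (w i i).
  by apply/lang_abaP; exists i.*2, i.*2.+2 => r; rewrite wE; lia.
have wNL (i j : 'I_(n./2)) : lang_aba (w i j) -> ~~ (i < j)%N.
  move=> /lang_abaP[lo [hi H]]; apply/negP => ij.
  (* For [i < j] the non-b position 2j lies strictly between the b-positions 2i and 2j + 1. *)
  by have := H i.*2; have := H j.*2; have := H j.*2.+1; rewrite !wE; lia.
apply: (@ooo_fooling _ _ _ lang_aba (fun p => ~~ odd p) _ w).
- by move=> v pi; exact: AL.
- move=> i k k' p /= pe; rewrite !tnth_mktuple.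
  have pF (j : 'I_(n./2)) : (p == j.*2.+1 :> nat) = false.
    by apply: contraNF pe => /eqP->; rewrite /= odd_double.
  by rewrite !pF.
- move=> i i' k p /=; rewrite negbK => po; rewrite !tnth_mktuple.
  have pF (j : 'I_(n./2)) : (p == j.*2 :> nat) = false.
    by apply: contraTF po => /eqP->; rewrite odd_double.
  by rewrite !pF.
(* Both columns [i] and [j] are tried: only a row smaller than its column is sure to be rejected, as
   [w i j] with i = j + 1 is in the language. *)
- move=> i j ijE; apply: ord_inj; apply/eqP.
  rewrite eqn_leq; apply/andP; split; rewrite leqNgt.
    exact: wNL ((ijE i).1 (wL i)).
  exact: wNL ((ijE j).2 (wL j)).
Qed.

Lemma lang_aba_space_O (R : realType) :
  ooo_space_O lang_aba (fun n : nat => ln (n%:R : R)).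
Proof.
exists span_machine, (fun n => (3 * (trunc_log 2 n).+1)%N); split.
- exact: span_machine_decides.
- move=> n n0; rewrite !card_prod !card_ord.
  rewrite -mulnA -[X in (X <= _)%N]/(n.+1 ^ 3)%N mulnC expnM leq_exp2r//.
  exact: trunc_log_ltn.
(* With t = [trunc_log 2 n], n >= 2 gives t >= 1, hence 3(t + 1) <= 6t, while t ln 2 <= ln n. *)
- apply/eqO_exP; exists (6 / ln 2); first by rewrite divr_gt0// ln_gt0// ltr1n.
  near=> n.
  have n2 : (2 <= n)%N by near: n; exists 2%N.
  have l2 : 0 < ln (2 : R) by rewrite ln_gt0// ltr1n.
  have t1 : (1 <= trunc_log 2 n)%N by apply: trunc_log_max.
  have tn : (2 ^ trunc_log 2 n <= n)%N by apply: trunc_logP => //; lia.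
  rewrite normr_nat ger0_norm; last by rewrite ln_ge0// ler1n; lia.
  have : (trunc_log 2 n)%:R * ln 2 <= ln (n%:R : R).
    rewrite mulr_natl -lnXn// ler_ln ?posrE ?exprn_gt0 ?ltr0n//; last by lia.
    by rewrite -natrX ler_nat.
  rewrite mulrAC ler_pdivlMr// => H.
  apply: (@le_trans _ _ ((6 * trunc_log 2 n)%:R * ln 2)).
    by rewrite ler_wpM2r// ?ler_nat; [exact: ltW|lia].
  by rewrite natrM -mulrA ler_wpM2l// ler0n.
Unshelve. all: by end_near. Qed.

(** The limsup is an infimum of suprema over neighbourhoods of infinity, and each neighbourhood
    contains an [n] where the ratio is at least [c]. *)
Lemma HL_Omega_near (R : realType) (f g : nat -> R) (c : R) :
  0 < c -> (\forall n \near \oo%classic, c <= f n / g n) -> HL_Omega f g.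
Proof.
move=> c0 cfg; rewrite /HL_Omega.
apply: (@lt_le_trans _ _ c%:E); first by rewrite lte_fin.
apply: le_ereal_inf_tmp => _ [V V_oo <-].
near \oo%classic => n.
apply: (@le_trans _ _ (f n / g n)%:E); first by rewrite lee_fin; near: n.
apply: ereal_sup_ubound; exists n => //; near: n; exact: V_oo.
Unshelve. all: by end_near. Qed.

Lemma lang_aba_space_Omega (R : realType) :
  ooo_space_Omega lang_aba (fun n : nat => ln (n%:R : R)).
Proof.
move=> A s AL As.
have l2 : 0 < ln (2 : R) by rewrite ln_gt0// ltr1n.
apply: (@HL_Omega_near _ _ _ (2 * ln 2)^-1); first by rewrite invr_gt0 mulr_gt0.
near=> n.
(* With m = [2 ^ s n], the state bound gives n <= 2m + 1, and n >= 6 forces m >= 3, so 2m + 1 <=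
   m^2. The exponent [2 * s n] explains the constant 1 / (2 ln 2). *)
have n6 : (6 <= n)%N by near: n; exists 6%N.
have n0 : (0 < n)%N by lia.
have nE : (n <= 2 ^ (2 * s n))%N.
  have := leq_trans (card_state_lower AL n0) (As n n0).
  by rewrite mulnC expnM; move: (2 ^ s n)%N => m; rewrite expnS expn1; nia.
have : ln (n%:R : R) <= (2 * s n)%:R * ln 2.
  rewrite mulr_natl -lnXn// ler_ln ?posrE ?exprn_gt0 ?ltr0n//.
  by rewrite -natrX ler_nat.
rewrite ler_pdivlMr; last by rewrite ln_gt0// ltr1n; lia.
by rewrite ler_pdivrMl ?mulr_gt0// natrM mulrAC.
Unshelve. all: by end_near. Qed.

Theorem proposition5p1 (R : realType) :
  ooo_space_Theta lang_aba (fun n : nat => ln (n%:R : R)).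
Proof. by split; [exact: lang_aba_space_O|exact: lang_aba_space_Omega]. Qed.
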